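(* Let $EC: S_0,S_1,S_2,\dots,S_{n-1},S_n(=S_0)$ be a unified cycle of length $n\geq 3$ with $|S_i|>1$ for some $i\in\{1,2,\dots,n\}$. For $i=1,\dots,n$ put $$p_i=\begin{cases}0, & \text{if } |S_{i-1}|=1 \text{ or } |S_i|=1,\\ \dfrac12\displaystyle\sum_{\substack{1\le l_1<|S_{i-1}|\\ 1\le l_2<|S_i|}}\binom{|S_{i-1}|}{l_1}\binom{|S_i|}{l_2}, & \text{otherwise},\end{cases}$$ and let $t_1=\sum_{i=1}^n p_i$ and $$t_2=\frac12\left[\Big(\sum_{e\in E(EC)}|\tau(e)|\Big)-n-t_1\right].$$ Then the unified eigenvalues of $EC$ (as a multiset, combining the following lists) are (i) $2\cos\left(\frac{2\pi k}{n}\right)$, with multiplicity $1$ for each $k=1,2,\dots,n$; (ii) $1$ and $-1$, each with multiplicity $t_1$, provided $|S_{i-1}|>1$ and $|S_i|>1$ for at least one $i\in\{1,\dots,n\}$; (iii) $0$, $\sqrt2$ and $-\sqrt2$, each with multiplicity $t_2$, provided $\sum_{e\in E(EC)}|\tau(e)|\neq n+t_1$.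
   Context: A hypergraph $H$ consists of a finite non-empty vertex set $V(H)$ and a multiset $E(H)$ of non-empty subsets of $V(H)$, called edges. A 2-partition of a set $e$ is an unordered pair $\{S,S'\}$ of non-empty disjoint sets with $S\cup S'=e$; $S$ and $S'$ are called parts of $e$, and $\tau(e)$ is the set of all 2-partitions of $e$. $I(H)$ is the set of all parts of all edges of $H$ together with all singleton subsets of $V(H)$. For a hypergraph without loops (edges of cardinality one) and without multiple edges, the unified matrix $\mathbf{U}(H)$ is the matrix indexed by $I(H)$ whose $(S,S')$ entry is $1$ if $\{S,S'\}$ is a 2-partition of an edge of $H$ and $0$ otherwise. The unified eigenvalues of $H$ are the eigenvalues of $\mathbf{U}(H)$, with multiplicity. A unified cycle $EC:S_0,S_1,\dots,S_{n-1},S_n=S_0$ of length $n\ge3$ is the hypergraph whose edges are exactly $e_i=S_{i-1}\cup S_i$, $i=1,\dots,n$ (each of multiplicity one), where $S_0,\dots,S_{n-1}$ are non-empty pairwise disjoint sets, and whose vertex set is $S_0\cup\dots\cup S_{n-1}$. *)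

(* Defs.v *)
(* The index conventions for a unified cycle follow the usual
   notation S_0, S_1, ..., S_{n-1}, S_n = S_0 literally, with S : nat -> {set T}
   of which only the values at 0, ..., n are used. *)
From HB Require Import structures.
From mathcomp Require Import all_boot all_order all_algebra.

Set Implicit Arguments.
Unset Strict Implicit.
Unset Printing Implicit Defensive.

Import GRing.Theory.
Local Open Scope ring_scope.

(* The vertex set is a subset of an ambient finite type T, and the multiset of
   edges is given by its multiplicity function. *)
Record hypergraph (T : finType) := Hypergraph {
  vertices : {set T};
  edge_mult : {ffun {set T} -> nat};
  vertices_neq0 : vertices != set0;
  edge_neq0 : forall e, (0 < edge_mult e)%N -> e != set0;
  edge_sub : forall e, (0 < edge_mult e)%N -> e \subset vertices
}.

Section Unified.
Variable T : finType.
Implicit Types (H : hypergraph T) (e A B : {set T}).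

Definition edges H : {set {set T}} := [set e | (0 < edge_mult H e)%N].

Definition loopless H : Prop := forall e, e \in edges H -> #|e| <> 1%N.
Definition no_multiple_edges H : Prop := forall e, (edge_mult H e <= 1)%N.

(* The unordered pair {S, S'} is the two-element set of sets [set S; S']. *)
Definition tau e : {set {set {set T}}} := [set P | partition P e & #|P| == 2].

Definition parts e : {set {set T}} := cover (tau e).

Definition unified_index H : {set {set T}} :=
  (\bigcup_(e in edges H) parts e) :|: [set [set v] | v in vertices H].

(* Used only for hypergraphs satisfying loopless and no_multiple_edges. *)
Definition unified_matrix (R : nzRingType) H : 'M[R]_#|unified_index H| :=
  \matrix_(i, j)
    [exists e in edges H, [set enum_val i; enum_val j] \in tau e]%:R.

(* s lists the eigenvalues of U(H), each repeated according to its
   multiplicity as a root of the characteristic polynomial; since the product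
   splits over R, there are no further eigenvalues in any extension of R. *)
Definition unified_eigenvalues (R : comNzRingType) H (s : seq R) : Prop :=
  char_poly (unified_matrix R H) = \prod_(a <- s) ('X - a%:P).

(* The sum over the multiset E(H) of |tau(e)|. *)
Definition sum_tau H : nat := (\sum_(e : {set T}) edge_mult H e * #|tau e|)%N.

Record unified_cycle H (n : nat) (S : nat -> {set T}) : Prop := UnifiedCycle {
  uc_length : (3 <= n)%N;
  uc_closed : S n = S 0%N;
  uc_neq0 : forall i, (i < n)%N -> S i != set0;
  uc_disjoint : forall i j, (i < n)%N -> (j < n)%N -> i != j ->
    [disjoint S i & S j];
  uc_vertices : vertices H = \bigcup_(i < n) S i;
  uc_edges : forall e,
    edge_mult H e = has (fun i => e == S i.-1 :|: S i) (iota 1 n)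
}.

Definition cycle_p (S : nat -> {set T}) (i : nat) : rat :=
  if (#|S i.-1| == 1%N) || (#|S i| == 1%N) then 0
  else 2^-1 * \sum_(1 <= l1 < #|S i.-1|) \sum_(1 <= l2 < #|S i|)
                ('C(#|S i.-1|, l1) * 'C(#|S i|, l2))%:R.

Definition cycle_t1 (n : nat) (S : nat -> {set T}) : rat :=
  \sum_(1 <= i < n.+1) cycle_p S i.

Definition cycle_t2 H (n : nat) (S : nat -> {set T}) : rat :=
  2^-1 * ((sum_tau H)%:R - n%:R - cycle_t1 n S).

Lemma unified_cycle_simple H n S :
  unified_cycle H n S -> loopless H /\ no_multiple_edges H.
Proof.
case=> n3 Sn S0 Sd _ He; split=> e; last by rewrite He; case: has.
rewrite inE He lt0b => /hasP[i]; rewrite mem_iota add1n ltnS.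
case: i => [|i] //= /= lt_in /eqP-> card1.
pose j := if i.+1 == n then 0%N else i.+1.
have Sj : S i.+1 = S j by rewrite /j; case: eqP => [->|].
have ltjn : (j < n)%N.
  rewrite /j; case: eqP => [_|/eqP nn]; first exact: leq_trans n3.
  by rewrite ltn_neqAle nn.
have neij : i != j.
  rewrite /j; case: (i.+1 =P n) => [ein|_]; last by rewrite (ltn_eqF (ltnSn i)).
  by apply/eqP=> i0; move: n3; rewrite -ein i0.
have := card1; rewrite Sj cardsU (disjoint_setI0 (Sd i j lt_in ltjn neij)).
rewrite cards0 subn0 => c1.
have := S0 i lt_in; have := S0 j ltjn; rewrite -!card_gt0.
by case: #|S i| c1 => [|a] //; case: #|S j| => [|b] //; rewrite addnS.
Qed.

End Unified.

Arguments unified_matrix {T} R H.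

(* Main.v *)
Require Import Defs.
From mathcomp Require Import all_boot all_order all_fingroup all_algebra.
From mathcomp Require Import ring lra zify.
From mathcomp Require complex.
From mathcomp Require Import reals trigo.

Set Implicit Arguments.
Unset Strict Implicit.
Unset Printing Implicit Defensive.

Import Order.TTheory GRing.Theory Num.Theory.
Local Open Scope ring_scope.

(** The matrix U(EC) is the adjacency matrix of the graph on I(EC) in which A
    and B are joined when {A, B} is a 2-partition of an edge, so its
    characteristic polynomial is the product over the connected components.
    These components can be listed.

    Say that A splits the block S_i when A contains some but not all points of
    S_i. An edge is a union of two blocks, so A and its complement in an edge
    split the same blocks, and at most two of them. Hence the graph falls
    apart according to the number of blocks that are split.
    - No block is split: the parts are the blocks themselves, each adjacent to
      the previous and to the next one. They form an n-cycle, whose spectrum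
      is 2 cos (2 pi k / n) ([part_poly_unsplit]).
    - Only S_i is split: each non-empty proper subset B of S_i is the
      middle of a path on three vertices, whose ends are the complements of B
      in the two edges that contain S_i. Such a path has characteristic
      polynomial X^3 - 2 X, with roots 0, sqrt 2 and - sqrt 2. Every part that
      splits only S_i lies on exactly one of these paths
      ([part_poly_split1]).
    - Two blocks are split: A lies in a single edge, so it is adjacent only to
      its complement there. These parts form a perfect matching, and each
      matched pair contributes X^2 - 1 ([part_poly_split2]).

    It remains to count. With a_i = 2 ^ |S_i| - 2 there are sum a_i paths, and
    sum (a_i a_(i+1)) parts in the matching, since such a part is the union of
    independently chosen proper parts of two consecutive blocks. The latter
    sum is 2 t_1 by the binomial theorem, and counting 2 |tau(e)| =
    2 ^ |e| - 2 edge by edge gives sum |tau(e)| = t_1 + 2 sum a_i + n, so that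
    t_2 = sum a_i. *)

(** * Characteristic polynomials of induced subgraphs *)

Section InducedCharPoly.
Variables (R : comNzRingType) (I : finType) (a : rel I).
Implicit Types X Y : {set I}.

Definition adj_mx m (f : 'I_m -> I) : 'M[R]_m := \matrix_(i, j) (a (f i) (f j))%:R.

(** The characteristic polynomial of the subgraph induced on X. *)
Definition induced_poly X : {poly R} := char_poly (adj_mx (fun i : 'I_#|X| => enum_val i)).

(** Independence of the enumeration: another one conjugates the adjacency
    matrix by a permutation, and the two signatures cancel. This is what makes
    the polynomial of a concrete small set computable. *)
Lemma induced_poly_enum m (f : 'I_m -> I) X :
  injective f -> [set f i | i in 'I_m] = X -> induced_poly X = char_poly (adj_mx f).
Proof.
move=> f_inj fX; have cX : #|X| = m by rewrite -fX card_imset // card_ord.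
have fXi i : f i \in X by rewrite -fX imset_f.
rewrite /induced_poly; move: (@enum_val I X) (@enum_val_inj I X) (@enum_valP I X).
rewrite cX => g g_inj gX.
have /fin_all_exists[s sE] i : exists j, f i = g j.
  have cg : [set g j | j in 'I_m] = X.
    by apply/eqP; rewrite eqEcard card_imset // card_ord cX leqnn andbT;
       apply/subsetP=> _ /imsetP[j _ ->].
  by move: (fXi i); rewrite -cg => /imsetP[j _ ->]; exists j.
have s_inj : injective s by move=> i j eqs; apply: f_inj; rewrite !sE eqs.
pose p := perm s_inj.
rewrite /char_poly.
have -> : char_poly_mx (adj_mx f) = row_perm p (col_perm p (char_poly_mx (adj_mx g))).
  by apply/matrixP=> i j; rewrite !mxE !permE !sE (inj_eq s_inj).
rewrite row_permE col_permE !det_mulmx !det_perm mulrC -mulrA odd_permV.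
by rewrite -signr_addb addbb mulr1.
Qed.

Lemma induced_poly0 : induced_poly set0 = 1.
Proof.
have f0 : injective (fun i : 'I_0 => match i with Ordinal _ h => False_rect I (notF h) end).
  by case.
rewrite (induced_poly_enum f0) /char_poly ?det_mx00 //.
by apply/setP=> x; rewrite inE; apply/imsetP=> -[[]].
Qed.

(** Enumerating the points of X that satisfy P before the others makes the
    adjacency matrix block diagonal. *)
Lemma induced_poly_split (P : pred I) X :
    {in X &, forall x y, P x != P y -> a x y = false} ->
  induced_poly X = induced_poly [set x in X | P x] * induced_poly [set x in X | ~~ P x].
Proof.
move=> aP; set Y := [set x in X | P x]; set Z := [set x in X | ~~ P x].
have YP (i : 'I_#|Y|) : (enum_val i \in X) /\ P (enum_val i).
  by apply/andP; have := enum_valP i; rewrite inE.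
have ZP (i : 'I_#|Z|) : (enum_val i \in X) /\ P (enum_val i) = false.
  by have := enum_valP i; rewrite inE => /andP[-> /negbTE->].
pose f (k : 'I_(#|Y| + #|Z|)) : I :=
  match split k with inl i => enum_val i | inr j => enum_val j end.
have fl i : f (lshift _ i) = enum_val i.
  by rewrite /f (unsplitK (inl i : 'I_#|Y| + 'I_#|Z|)).
have fr i : f (rshift _ i) = enum_val i.
  by rewrite /f (unsplitK (inr i : 'I_#|Y| + 'I_#|Z|)).
rewrite (@induced_poly_enum _ f).
- have -> : adj_mx f = block_mx (adj_mx (fun i : 'I_#|Y| => enum_val i)) 0
                            0 (adj_mx (fun i : 'I_#|Z| => enum_val i)).
    apply/matrixP=> i j; rewrite !mxE.
    case: (split_ordP i) => i' ->; case: (split_ordP j) => j' ->;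
      rewrite ?fl ?fr !mxE ?(unsplitK (inl _)) ?(unsplitK (inr _)) /= !mxE
              ?(unsplitK (inl _)) ?(unsplitK (inr _)) //= ?mxE //.
    + by rewrite aP ?(YP i').1 ?(ZP j').1 ?(YP i').2 ?(ZP j').2.
    + by rewrite aP ?(YP j').1 ?(ZP i').1 ?(YP j').2 ?(ZP i').2.
  by rewrite /char_poly char_block_diag_mx det_ublock.
- move=> i j; case: (split_ordP i) => i' ->; case: (split_ordP j) => j' ->;
    rewrite ?fl ?fr => eqf.
  + by rewrite (enum_val_inj eqf).
  + by have := (YP i').2; rewrite eqf (ZP j').2.
  + by have := (YP j').2; rewrite -eqf (ZP i').2.
  + by rewrite (enum_val_inj eqf).
- apply/setP=> x; apply/imsetP/idP => [[i _ ->]|xX].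
    by case: (split_ordP i) => i' ->; rewrite ?fl ?fr; [case: (YP i')|case: (ZP i')].
  have [Px|nPx] := boolP (P x).
    have xY : x \in Y by rewrite inE xX.
    by exists (lshift _ (enum_rank_in xY x)); rewrite // fl enum_rankK_in.
  have xZ : x \in Z by rewrite inE xX.
  by exists (rshift _ (enum_rank_in xZ x)); rewrite // fr enum_rankK_in.
Qed.

(** A labelling that is constant along edges cuts the graph into its fibres;
    this avoids any explicit handling of connected components. *)
Lemma induced_poly_uniform_fibres (L : finType) (c : I -> L) X q :
    {in X &, forall x y, a x y -> c x = c y} ->
    {in X, forall x, induced_poly [set y in X | c y == c x] = q} ->
  induced_poly X = q ^+ #|c @: X|.
Proof.
elim: {X}_.+1 {-2}X (ltnSn #|X|) => // m IHm X leX ac cq.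
have [->|[x xX]] := set_0Vmem X; first by rewrite imset0 cards0 induced_poly0.
rewrite (@induced_poly_split (fun y => c y == c x)) => [|y z yX zX]; last first.
  by apply: contraNF => /(ac y z yX zX)->.
set Z := [set y in X | c y != c x].
have ZX : Z \subset X by apply/subsetP=> y; rewrite inE => /andP[].
have ltZX : (#|Z| < #|X|)%N.
  by rewrite proper_card // properE ZX; apply/subsetPn; exists x; rewrite // inE xX eqxx.
have -> : induced_poly Z = q ^+ #|c @: Z|.
  apply: IHm => [|y z /(subsetP ZX) yX /(subsetP ZX) zX|y].
  - exact: leq_trans ltZX leX.
  - exact: ac.
  rewrite inE => /andP[yX yx]; rewrite -(cq y yX); congr induced_poly.
  apply/setP=> z; rewrite !inE -andbA; congr (_ && _).
  by case: (eqVneq (c z) (c y)) => [->|]; rewrite ?yx ?andbF.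
rewrite cq //.
have -> : c @: Z = (c @: X) :\ c x.
  apply/setP=> l; rewrite !inE; apply/imsetP/andP.
    by case=> y; rewrite inE => /andP[yX yx] ->; rewrite imset_f.
  by case=> lx /imsetP[y yX el]; exists y; rewrite // inE yX -el.
by rewrite -exprS [in RHS](cardsD1 (c x)) imset_f.
Qed.

End InducedCharPoly.

Section SmallGraphs.
Variables (R : comNzRingType) (I : finType) (a : rel I).
Hypotheses (a_sym : symmetric a) (a_irr : irreflexive a).
Implicit Types X Y : {set I}.

Lemma induced_poly_edge x y : a x y -> induced_poly R a [set x; y] = 'X ^+ 2 - 1.
Proof.
move=> axy; pose f (i : 'I_2) := nth x [:: x; y] i.
have neq_xy : x != y by apply: contraTneq axy => ->; rewrite a_irr.
have f_inj : injective f.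
  move=> i j /eqP; rewrite nth_uniq ?ltn_ord //; first by move/eqP/val_inj.
  by rewrite /= inE neq_xy.
rewrite (induced_poly_enum _ _ f_inj); last first.
  apply/setP=> z; rewrite !inE; apply/imsetP/orP => [[[[|[|//]] ?] _ ->]|].
  - by left.
  - by right.
  - by case=> /eqP->; [exists ord0|exists ord_max].
rewrite /char_poly (expand_det_row _ ord0) !big_ord_recl big_ord0 /=.
rewrite /cofactor !det_mx11 !mxE /f /= !a_irr axy a_sym axy.
by rewrite !expr0 !expr1 /= !mulr1n !mulr0n !rmorph0 !rmorph1; ring.
Qed.

Lemma induced_poly_path x y z : a x y -> a x z -> ~~ a y z -> y != z ->
  induced_poly R a [set x; y; z] = 'X ^+ 3 - 'X *+ 2.
Proof.
move=> axy axz ayz yz; pose f (i : 'I_3) := nth x [:: x; y; z] i.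
have neq_xy : x != y by apply: contraTneq axy => ->; rewrite a_irr.
have neq_xz : x != z by apply: contraTneq axz => ->; rewrite a_irr.
have f_inj : injective f.
  move=> i j /eqP; rewrite nth_uniq ?ltn_ord //; first by move/eqP/val_inj.
  by rewrite /= !inE negb_or neq_xy neq_xz yz.
rewrite (induced_poly_enum _ _ f_inj); last first.
  apply/setP=> t; rewrite !inE -orbA; apply/imsetP/or3P => [[[[|[|[|//]]] ?] _ ->]|].
  - exact: Or31.
  - exact: Or32.
  - exact: Or33.
  - by case=> /eqP->; [exists ord0|exists (@Ordinal 3 1 isT)|exists ord_max].
rewrite /char_poly (expand_det_row _ ord0) !big_ord_recl big_ord0 /=.
rewrite /cofactor !(expand_det_row _ ord0) !big_ord_recl !big_ord0 /=.
rewrite /cofactor !det_mx11 !mxE /f /= !a_irr axy axz ![a _ x]a_sym axy axz.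
rewrite [a z y]a_sym (negbTE ayz).
by rewrite !expr0 !expr1 /= !mulr1n !mulr0n !rmorph0 !rmorph1; ring.
Qed.

(** The unordered pairs {x, s x} serve as labels: each fibre is a single edge. *)
Lemma induced_poly_matching (s : I -> I) X :
    {in X, forall x, s x \in X} ->
    {in X &, forall x y, a x y = (y == s x)} ->
  exists m, #|X| = (2 * m)%N /\ induced_poly R a X = ('X ^+ 2 - 1) ^+ m.
Proof.
move=> sX aE; have ss : {in X, involutive s}.
  by move=> x xX; apply/esym/eqP; rewrite -aE ?sX // a_sym aE ?sX.
have s_irr : {in X, forall x, s x != x}.
  by move=> x xX; rewrite eq_sym -aE ?a_irr.
pose c x := [set x; s x].
have cE : {in X &, forall x y, (c y == c x) = (y \in c x)}.
  move=> x y xX yX; apply/eqP/idP => [<-|]; first exact: set21.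
  by rewrite !inE => /orP[] /eqP-> //; rewrite /c ss // setUC.
have fibre : {in X, forall x, [set y in X | c y == c x] = c x}.
  move=> x xX; apply/setP=> y; rewrite !inE.
  apply/andP/orP => [[yX]|]; first by rewrite cE // !inE => /orP.
  by case=> /eqP->; rewrite cE ?sX // ?inE ?eqxx ?orbT ?xX.
exists #|c @: X|; split; last first.
  apply: (induced_poly_uniform_fibres (c := c)) => [x y xX yX|x xX].
    by rewrite aE // => /eqP->; rewrite /c ss // setUC.
  by rewrite fibre // induced_poly_edge // aE ?sX ?eqxx.
rewrite -sum1_card (partition_big_imset c) /= mulnC -sum_nat_const.
apply: eq_bigr => _ /imsetP[x xX ->].
by rewrite sum1dep_card fibre // cards2 eq_sym s_irr.
Qed.

End SmallGraphs.

(** * The spectrum of the n-cycle *)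

Section Cycle.
Variable n : nat.
Hypothesis n_gt2 : (2 < n)%N.

Definition cycle_adj : rel 'I_n := fun i j => (j == ordS i) || (i == ordS j).

Lemma ordS_neq (i : 'I_n) : ordS i != i.
Proof.
apply/eqP=> /(congr1 val) /=; case: (ltngtP i.+1 n) (ltn_ord i) => // h _.
  by rewrite modn_small // => /esym/n_Sn.
by rewrite h modnn => i0; have := n_gt2; rewrite -[n in (_ < n)%N]h -i0.
Qed.

Lemma ordSS_neq (i : 'I_n) : ordS (ordS i) != i.
Proof.
apply/eqP=> /(congr1 val) /=.
have -> : ((i.+1 %% n).+1 %% n = (i + 2) %% n)%N by rewrite -addn1 modnDml addn1 addn2.
case: (ltnP (i + 2) n) => h; first by rewrite modn_small //; lia.
have := ltn_ord i => hi.
have -> : (i + 2 = (i + 2 - n) + n)%N by rewrite subnK.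
rewrite modnDr modn_small; lia.
Qed.

(** The Vandermonde matrix of the n-th roots of unity diagonalizes the cycle:
    the vector of powers of a root z is multiplied by z + z^-1, because moving
    to the next or previous index modulo n multiplies by z or z^-1. *)
Lemma char_poly_cycle_field (F : fieldType) (a : 'I_n -> F) :
    injective a -> (forall k, a k ^+ n = 1) ->
  char_poly (adj_mx F cycle_adj id) = \prod_k ('X - (a k + (a k)^-1)%:P).
Proof.
move=> a_inj an.
have a_neq0 k : a k != 0.
  apply/eqP=> ak0; have /eqP := an k.
  by rewrite ak0 expr0n eq_sym (gtn_eqF (ltn_trans _ n_gt2)) // oner_eq0.
pose r := \row_k a k; pose V := Vandermonde n r.
pose C : 'M[F]_n := adj_mx F cycle_adj id.
pose d := \row_k (a k + (a k)^-1).
have detV : \det V != 0.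
  rewrite det_Vandermonde; apply/prodf_neq0 => i _; apply/prodf_neq0 => j ij.
  by rewrite !mxE subr_eq0 (inj_eq a_inj) -val_eqE gtn_eqF.
have aS k (i : 'I_n) : a k ^+ ordS i = a k ^+ i * a k.
  by rewrite /= expr_mod // exprSr.
have aP k (i : 'I_n) : a k ^+ ord_pred i = a k ^+ i / a k.
  by rewrite -{2}(ord_predK i) aS mulfK.
have CV : C *m V = V *m diag_mx d.
  apply/matrixP=> i k; rewrite mul_mx_diag !mxE.
  rewrite (bigD1 (ordS i)) //= (bigD1 (ord_pred i)) /=; last first.
    by rewrite -(inj_eq (@ordS_inj n)) ord_predK eq_sym ordSS_neq.
  rewrite big1 => [|j /andP[jS jP]]; last first.
    rewrite !mxE /cycle_adj (negbTE jS) -(inj_eq (@ord_pred_inj n)) ordSK.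
    by rewrite eq_sym (negbTE jP) mul0r.
  by rewrite !mxE /cycle_adj eqxx ord_predK eqxx orbT !mul1r aS aP addr0 mulrDr.
have /(congr1 determinant) :
    char_poly_mx C *m map_mx polyC V = map_mx polyC V *m char_poly_mx (diag_mx d).
  rewrite mulmxBl mulmxBr -!map_mxM CV; congr (_ - _).
  by rewrite scalar_mxC.
rewrite !det_mulmx mulrC det_map_mx => /mulfI; rewrite polyC_eq0 => /(_ detV).
rewrite -/C -[char_poly C]/(\det _) => ->.
rewrite -/(char_poly _) char_poly_trig ?diag_mx_is_trig //.
by apply: eq_bigr => k _; rewrite !mxE eqxx.
Qed.

Section Roots.
Import complex.
Variable R : realType.
Let t : R := 2 * pi / n%:R.

(** The k-th power of exp (2 i pi / n), as [zetaD] shows. *)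
Let zeta (k : nat) : R[i] := (cos (k%:R * t) +i* sin (k%:R * t))%C.

Lemma zetaD j k : zeta (j + k) = zeta j * zeta k.
Proof.
rewrite /zeta natrD mulrDl cosD sinD; apply/eqP; rewrite eq_complex /= eqxx /=.
by apply/eqP; ring.
Qed.

Lemma zeta0 : zeta 0 = 1.
Proof. by rewrite /zeta mul0r cos0 sin0. Qed.

(** By the double angle formula, cos (2 y) = 1 - 2 (sin y)^2 with
    y = pi k / n in the open interval from 0 to pi, where sin is positive. *)
Lemma zeta_neq1 k : (0 < k < n)%N -> zeta k != 1.
Proof.
move=> /andP[k0 kn]; have n0 : 0 < n%:R :> R by rewrite ltr0n; lia.
pose y : R := pi * (k%:R / n%:R).
have ty : k%:R * t = y *+ 2 by rewrite /t /y; ring.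
rewrite eq_complex /= negb_and ty cos_mulr2n cos2sin2 lt_eqF //.
suff : 0 < sin y ^+ 2 by lra.
rewrite exprn_gt0 // sin_gt0_pi // /y mulr_gt0 ?pi_gt0 ?divr_gt0 ?ltr0n ?(leq_ltn_trans _ kn) //=.
by rewrite -[ltRHS]mulr1 ltr_pM2l ?pi_gt0 // ltr_pdivrMr // mul1r ltr_nat.
Qed.

Lemma zetan : zeta n = 1.
Proof.
have n0 : n%:R != 0 :> R by rewrite pnatr_eq0; case: n n_gt2.
have -> : zeta n = (cos (pi *+ 2) +i* sin (pi *+ 2))%C.
  by rewrite /zeta /t (_ : _ * _ = pi *+ 2) //; field.
by rewrite cos2pi sin2pi.
Qed.

(** The roots of unity are complex, so the computation is done over R[i] and
    pulled back along the embedding of R, which is injective on polynomials. *)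
Lemma char_poly_cycle :
  char_poly (adj_mx R cycle_adj id)
  = \prod_(k <- iota 1 n) ('X - (2 * cos (2 * pi * k%:R / n%:R))%:P).
Proof.
apply: (map_poly_inj (real_complex R)).
rewrite map_char_poly.
have -> : map_mx (real_complex R) (adj_mx R cycle_adj id) = adj_mx _ cycle_adj id.
  by apply/matrixP=> i j; rewrite !mxE rmorph_nat.
have zetaX m k : zeta k ^+ m = zeta (k * m).
  by elim: m => [|m IHm]; rewrite ?muln0 ?zeta0 // exprS IHm mulnS zetaD.
have zeta_neq0 k : zeta k != 0.
  apply: contraTneq (oner_neq0 R[i]) => zk0.
  by rewrite -(expr1n _ k) -zetan zetaX mulnC -zetaX zk0 expr0n gtn_eqF ?eqxx // ltnW // ltnW.
rewrite (@char_poly_cycle_field _ (fun k => zeta k.+1)); first last.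
- by move=> k; rewrite zetaX mulnC -zetaX zetan expr1n.
- have zeta_lt (i j : 'I_n) : (i < j)%N -> zeta i.+1 != zeta j.+1.
    move=> ij; have -> : (j.+1 = i.+1 + (j - i))%N by rewrite addSn subnKC // ltnW.
    rewrite zetaD -subr_eq0 -{1}[zeta i.+1]mulr1 -mulrBr mulf_neq0 //; last first.
      by rewrite subr_eq0 eq_sym zeta_neq1 // subn_gt0 ij /= (leq_ltn_trans (leq_subr _ _)).
  move=> i j /eqP; apply: contraTeq => ne_ij.
  by case: (ltngtP i j) ne_ij => [/zeta_lt //|/zeta_lt|/val_inj->]; rewrite ?eqxx // eq_sym.
have -> : iota 1 n = map S (index_iota 0 n) by rewrite /index_iota subn0 -(iotaDl 1).
rewrite big_map big_mkord rmorph_prod.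
apply: eq_bigr => k _ /=; rewrite rmorphB /= map_polyX map_polyC /=; congr ('X - _%:P).
have -> : (zeta k.+1)^-1 = (cos (k.+1%:R * t) -i* sin (k.+1%:R * t))%C.
  apply: (mulfI (zeta_neq0 k.+1)); rewrite divff ?zeta_neq0 // /zeta.
  move: (k.+1%:R * t) => u; apply/eqP; rewrite eq_complex /= -(cos2Dsin2 u).
  by apply/andP; split; apply/eqP; ring.
rewrite /zeta -[S k]add1n; apply/eqP; rewrite eq_complex /= subrr eqxx andbT.
by apply/eqP; rewrite (_ : 2 * pi * _ / _ = k.+1%:R * t) /t; ring.
Qed.

End Roots.
End Cycle.

(** * Parts of the edges of a cycle of blocks *)

Definition proper_parts (T : finType) (X : {set T}) := [set B | (B != set0) && (B \proper X)].

Lemma card_proper_parts (T : finType) (X : {set T}) :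
  X != set0 -> #|proper_parts X| = (2 ^ #|X| - 2)%N.
Proof.
move=> X0; have -> : proper_parts X = powerset X :\ set0 :\ X.
  by apply/setP=> B; rewrite !inE properEneq andbCA andbA.
have := cardsD1 set0 (powerset X); rewrite inE sub0set card_powerset.
have := cardsD1 X (powerset X :\ set0); rewrite !inE X0 subxx /=.
lia.
Qed.

Lemma proper_parts_sub (T : finType) (X B : {set T}) :
  B \in proper_parts X -> B \subset X.
Proof. by rewrite inE => /andP[_ /proper_sub]. Qed.

Lemma proper_parts_compl (T : finType) (X B : {set T}) :
  B \in proper_parts X -> X :\: B \in proper_parts X.
Proof.
rewrite !inE => /andP[/set0Pn[x xB] /andP[sB nsB]]; rewrite setD_eq0 nsB properE subsetDl.
by apply/subsetPn; exists x; rewrite ?(subsetP sB) // inE xB.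
Qed.

Section Blocks.
Variables (T : finType) (n : nat) (V : 'I_n -> {set T}).
Hypothesis n_gt2 : (2 < n)%N.
Hypothesis V_neq0 : forall i, V i != set0.
Hypothesis V_inj : forall x i j, x \in V i -> x \in V j -> i = j.
Implicit Types (A B : {set T}) (i j k : 'I_n).

(** The index runs modulo n through the cyclic successor [ordS], which is how
    the closing condition S_n = S_0 is encoded. *)
Definition cedge i := V i :|: V (ordS i).

Definition part_adj : rel {set T} := fun A B =>
  [exists i, [&& A != set0, B != set0, [disjoint A & B] & A :|: B == cedge i]].

(** The vertices of the graph whose adjacency relation is [part_adj]. *)
Definition cparts : {set {set T}} :=
  [set A | [exists i, (A != set0) && (A \proper cedge i)]].

Definition split_blocks A :=
  [set i | (A :&: V i != set0) && ~~ (V i \subset A)].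

Lemma cedgeP x i j : x \in V j -> (x \in cedge i) = (j == i) || (j == ordS i).
Proof.
move=> xj; rewrite inE; apply/orP/orP => -[].
- by move/(V_inj xj)=> ->; left.
- by move/(V_inj xj)=> ->; right.
- by move/eqP<-; left.
- by move/eqP<-; right.
Qed.

Lemma part_adjP A B :
  reflect (exists i, [/\ A != set0, A \proper cedge i & B = cedge i :\: A]) (part_adj A B).
Proof.
apply: (iffP existsP) => -[i].
  case/and4P=> A0 B0 dAB /eqP eAB; exists i; split=> //.
    rewrite -eAB properUl //; apply: contraNN B0 => /setIidPl BA.
    by rewrite -BA setIC disjoint_setI0.
  by rewrite -eAB setDUl setDv set0U; apply/esym/setDidPl; rewrite disjoint_sym.
case=> A0 pA ->; exists i; rewrite A0 /=; apply/and3P; split.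
- by apply: contraTneq pA => /eqP; rewrite setD_eq0 properE => ->; rewrite andbF.
- by rewrite -setI_eq0 setIDA setDIl setDv set0I.
- by rewrite -{1}(setIidPr (proper_sub pA)) setID.
Qed.

Lemma part_adj_sym : symmetric part_adj.
Proof.
move=> A B; apply: eq_existsb => i.
by rewrite andbCA disjoint_sym setUC.
Qed.

Lemma part_adj_irr : irreflexive part_adj.
Proof.
move=> A; apply/existsP=> -[i /and4P[A0 _]].
by rewrite -setI_eq0 setIid (negbTE A0).
Qed.

Lemma splitP A j :
  reflect (exists x y, [/\ x \in V j, y \in V j, x \in A & y \notin A])
          (j \in split_blocks A).
Proof.
rewrite inE; apply: (iffP andP) => [[/set0Pn[x] + /subsetPn[y yj yA]]|[x [y [xj yj xA yA]]]].
  by rewrite inE => /andP[xA xj]; exists x, y.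
by split; [apply/set0Pn; exists x; rewrite inE xA|apply/subsetPn; exists y].
Qed.

(** If x and y in V j witness that A splits V j, then both lie in the edge, so
    exchanging them witnesses that the complement splits V j. *)
Lemma split_compl A i :
  A \subset cedge i -> split_blocks (cedge i :\: A) = split_blocks A.
Proof.
move=> /subsetP sA; apply/setP=> j; apply/splitP/splitP=> -[x [y [xj yj]]].
  rewrite !in_setD => /andP[xA xe].
  have ye : y \in cedge i by rewrite (cedgeP _ yj) -(cedgeP _ xj).
  by rewrite ye andbT negbK => yA; exists y, x.
move=> xA yA; have ye : y \in cedge i by rewrite (cedgeP _ yj) -(cedgeP _ xj) sA.
by exists y, x; split; rewrite // in_setD ?yA ?xA.
Qed.

Lemma part_adj_split A B : part_adj A B -> split_blocks A = split_blocks B.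
Proof. by case/part_adjP=> i [_ /proper_sub sA ->]; rewrite split_compl. Qed.

Lemma split_sub A i : A \subset cedge i -> split_blocks A \subset [set i; ordS i].
Proof.
move=> /subsetP sA; apply/subsetP=> j /splitP[x [_ [xj _ xA _]]].
by rewrite !inE -(cedgeP _ xj) sA.
Qed.

Lemma unsplit_sub A j x : j \notin split_blocks A -> x \in V j -> x \in A -> V j \subset A.
Proof.
rewrite inE negb_and !negbK => /orP[/eqP A0|//] xj xA.
by have := in_set0 x; rewrite -A0 inE xA xj.
Qed.

Lemma V_eq i j : V i = V j -> i = j.
Proof. by have /set0Pn[x xi] := V_neq0 i => eV; apply: (V_inj xi); rewrite -eV. Qed.

Lemma V_sub_cedge i j : (V j \subset cedge i) = (j == i) || (j == ordS i).
Proof.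
apply/idP/orP=> [/subsetP sV|]; last first.
  by case=> /eqP->; [apply: subsetUl|apply: subsetUr].
by have /set0Pn[x xj] := V_neq0 j; apply/orP; rewrite -(cedgeP _ xj) sV.
Qed.

Lemma disjV i j : i != j -> [disjoint V i & V j].
Proof.
move=> ij; rewrite disjoint_subset; apply/subsetP=> x xi; rewrite inE.
by apply: contraNN ij => xj; rewrite (V_inj xi xj).
Qed.

Lemma V_proper_cedge i : (V i \proper cedge i) && (V (ordS i) \proper cedge i).
Proof.
have := ordS_neq n_gt2 i => Si.
have h j k : j != k -> ~~ (V j \subset V k).
  move=> jk; have /set0Pn[x xj] := V_neq0 j; apply/subsetPn; exists x => //.
  by apply: contraNN jk => xk; rewrite (V_inj xj xk).
apply/andP; rewrite /cedge; split; first by rewrite properUl // h.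
by rewrite properUr // h // eq_sym.
Qed.

(** A part that splits no block contains each block that it meets, and being
    proper in its edge it meets only one. *)
Lemma unsplit_parts :
  [set A in cparts | split_blocks A == set0] = [set V i | i in 'I_n].
Proof.
apply/setP=> A; rewrite !inE; apply/andP/imsetP => [[/existsP[i /andP[A0 pA]] /eqP sp]|[i _ ->]].
  have full j x : x \in A -> x \in V j -> V j \subset A.
    by move=> xA xj; apply: (unsplit_sub _ xj xA); rewrite sp inE.
  have key j k : cedge i = V j :|: V k -> V j \subset A -> A = V j.
    move=> eE jA; apply/eqP; rewrite eqEsubset jA andbT.
    apply/subsetP=> y yA; move: (subsetP (proper_sub pA) y yA); rewrite eE inE.
    case/orP=> // yk; move: pA; rewrite eE properE => /andP[_ /negP[]].
    by rewrite subUset jA (full k y).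
  have /set0Pn[x xA] := A0; move: (subsetP (proper_sub pA) x xA); rewrite inE.
  case/orP=> [xi|xi].
  - by exists i => //; apply: (key _ (ordS i)) => //; apply: (full _ x).
  - by exists (ordS i) => //; apply: (key _ i); [rewrite setUC|apply: (full _ x)].
split; first by apply/existsP; exists i; rewrite V_neq0; case/andP: (V_proper_cedge i).
apply/eqP/setP=> j; rewrite [RHS]inE; apply/splitP=> -[x [y [xj yj xi]]].
by rewrite (V_inj xi xj) yj.
Qed.

Lemma part_adj_V i j : part_adj (V i) (V j) = cycle_adj i j.
Proof.
apply/idP/orP=> [/existsP[k /and4P[_ _ dij /eqP eE]]|].
  have ij : i != j by apply: contraTneq dij => ->; rewrite -setI_eq0 setIid V_neq0.
  have : (V i \subset cedge k) && (V j \subset cedge k) by rewrite -eE subsetUl subsetUr.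
  rewrite !V_sub_cedge => /andP[/orP[]/eqP ei /orP[]/eqP ej]; move: ij;
    rewrite ei ej ?eqxx // => _; by [left|right].
have h k : part_adj (V k) (V (ordS k)).
  apply/existsP; exists k; rewrite !V_neq0 disjV ?eqxx // eq_sym; exact: ordS_neq.
by case=> /eqP->; rewrite ?h // part_adj_sym h.
Qed.

Definition support A := \bigcup_(i in split_blocks A) V i.

(** For a part that splits exactly one block, the middle of the path through
    it: the part itself when it lies inside the block, and the complement in
    the block of its trace on the block when it is an end. The second case is
    computed by removing the part from the block. *)
Definition center A := if A \subset support A then A else support A :\: A.

(** The path on three vertices with middle B; its ends are the complements of
    B in the two edges that contain the block V i. *)
Definition star i B :=
  [set B; (V i :\: B) :|: V (ordS i); (V i :\: B) :|: V (ord_pred i)].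

Lemma in_starE i B A : (A \in star i B) =
  [|| A == B, A == (V i :\: B) :|: V (ordS i) | A == (V i :\: B) :|: V (ord_pred i)].
Proof. by rewrite !inE -orbA. Qed.

Lemma support1 A i : split_blocks A = [set i] -> support A = V i.
Proof. by rewrite /support => ->; rewrite big_set1. Qed.

Lemma support2 A i : split_blocks A = [set i; ordS i] -> support A = cedge i.
Proof.
by rewrite /support => ->; rewrite big_setU1 ?big_set1 // inE eq_sym ordS_neq.
Qed.

Lemma cedge_pred i : cedge (ord_pred i) = V i :|: V (ord_pred i).
Proof. by rewrite /cedge ord_predK setUC. Qed.

Lemma ord_pred_neq i : ord_pred i != i.
Proof. by rewrite -(inj_eq (@ordS_inj n)) ord_predK eq_sym ordS_neq. Qed.

Lemma ordS_neq_pred i : ordS i != ord_pred i.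
Proof. by rewrite -(inj_eq (@ordS_inj n)) ord_predK ordSS_neq. Qed.

(** Adding a whole block to a part does not change which blocks it splits. *)
Lemma split_eq1 A i B j : B \in proper_parts (V i) -> i != j ->
  A = B \/ A = B :|: V j -> split_blocks A = [set i].
Proof.
rewrite inE => /andP[/set0Pn[x xB] /properP[sB [y yi yB]]] ij eA.
have xi := subsetP sB x xB.
have AE z : z \in V i -> (z \in A) = (z \in B).
  move=> zi; case: eA => -> //; rewrite inE orbC; case: (boolP (z \in V j)) => // zj.
  by rewrite (V_inj zi zj) eqxx in ij.
apply/setP=> k; rewrite [RHS]inE; apply/splitP/eqP => [[u [v [uk vk uA vA]]]|->].
  move: uA vA; case: eA => -> uA.
    by move=> _; apply: (V_inj uk); apply: (subsetP sB).
  rewrite inE negb_or => /andP[_ vj]; move: uA; rewrite inE => /orP[uB|uj].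
    by apply: (V_inj uk); apply: (subsetP sB).
  by rewrite -(V_inj uk uj) vk in vj.
by exists x, y; rewrite !AE.
Qed.

Lemma center_star i B A : B \in proper_parts (V i) -> A \in star i B ->
  [/\ A \in cparts, split_blocks A = [set i] & center A = B].
Proof.
move=> Bi; have Ci := proper_parts_compl Bi.
have pS : i != ordS i by rewrite eq_sym ordS_neq.
have pP : i != ord_pred i by rewrite eq_sym ord_pred_neq.
have [B0 pB] : B != set0 /\ B \proper V i by move: Bi; rewrite inE => /andP[].
have [C0 pC] : V i :\: B != set0 /\ V i :\: B \proper V i by move: Ci; rewrite inE => /andP[].
have DD : V i :\: (V i :\: B) = B by rewrite setDDr setDv set0U (setIidPr (proper_sub pB)).
have Cd k : i != k -> ~~ ((V i :\: B) :|: V k \subset V i).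
  move=> ik; have /set0Pn[x xk] := V_neq0 k; apply/subsetPn; exists x; first by rewrite inE xk orbT.
  by apply: contraNN ik => xi; rewrite (V_inj xi xk).
have CD k : i != k -> V i :\: ((V i :\: B) :|: V k) = B.
  move=> ik; rewrite setDUr DD; apply/setIidPl; apply: subset_trans (proper_sub pB) _.
  by rewrite subsetD subxx disjV.
have CW k j : i != k -> cedge j = V i :|: V k -> (V i :\: B) :|: V k \in cparts.
  move=> ik ej; rewrite inE; apply/existsP; exists j; rewrite ej properE setSU ?subsetDl //=.
  rewrite -subset0 subUset subset0 (negbTE C0) /=.
  have /set0Pn[x xB] := B0; have xi := subsetP (proper_sub pB) x xB.
  apply/subsetPn; exists x; rewrite !inE ?xi ?xB //=.
  by apply: contraNN ik => xk; rewrite (V_inj xi xk).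
rewrite in_starE => /or3P[]/eqP->.
- have sp : split_blocks B = [set i] by apply: (split_eq1 Bi pS); left.
  split=> //; last by rewrite /center (support1 sp) (proper_sub pB).
  by rewrite inE; apply/existsP; exists i; rewrite B0 (proper_sub_trans pB) // subsetUl.
- have sp := split_eq1 Ci pS (or_intror erefl); split=> //.
    exact: (CW _ i).
  by rewrite /center (support1 sp) (negbTE (Cd _ pS)) CD.
- have sp := split_eq1 Ci pP (or_intror erefl); split=> //.
    by apply: (CW _ (ord_pred i)) => //; rewrite cedge_pred.
  by rewrite /center (support1 sp) (negbTE (Cd _ pP)) CD.
Qed.

(** Let A lie in the edge V i + V k and split only V i. If A meets V k it
    contains it, so A is an end of the path whose middle is V i minus A;
    otherwise A lies in V i and is itself a middle. *)
Lemma in_star A i : A \in cparts -> split_blocks A = [set i] ->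
  exists2 B, B \in proper_parts (V i) & A \in star i B.
Proof.
rewrite inE => /existsP[j /andP[A0 pA]] sp.
have Ai : A :&: V i \in proper_parts (V i).
  have : i \in split_blocks A by rewrite sp inE.
  by rewrite !inE properE subsetIr subsetI subxx andbT.
have key k : k != i -> A \subset V i :|: V k ->
    A \in proper_parts (V i) \/ A = (A :&: V i) :|: V k.
  move=> ki sA; case: (boolP (A \subset V i)) => [AV|/subsetPn[x xA xi]].
    by left; rewrite -(setIidPl AV).
  right; have xk : x \in V k by move: (subsetP sA x xA); rewrite inE (negbTE xi).
  have kA : V k \subset A by apply: (unsplit_sub _ xk xA); rewrite sp inE.
  by rewrite -(setIidPr kA) -setIUr; apply/esym/setIidPl.
have ij : i \in [set j; ordS j].
  by apply: (subsetP (split_sub (proper_sub pA))); rewrite sp inE.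
have DD : V i :\: (V i :\: A :&: V i) = A :&: V i.
  by rewrite setDDr setDv set0U (setIidPr (subsetIr _ _)).
have [|] : A \in proper_parts (V i) \/
    (A = (A :&: V i) :|: V (ordS i) \/ A = (A :&: V i) :|: V (ord_pred i)).
- move: ij; rewrite in_set2 => /orP[]/eqP ij.
    rewrite -ij in pA; case: (key _ (ordS_neq n_gt2 i) (proper_sub pA)); first by left.
    by right; left.
  have jE : j = ord_pred i by rewrite ij ordSK.
  rewrite jE cedge_pred in pA.
  case: (key _ (ord_pred_neq i) (proper_sub pA)); first by left.
  by right; right.
- by exists A; rewrite // in_starE eqxx.
- move=> eA; exists (V i :\: A :&: V i); first exact: proper_parts_compl.
  by rewrite in_starE DD; case: eA => <-; rewrite eqxx !orbT.
Qed.

Lemma center_compl i k B : B \subset V i -> i != k ->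
  (V i :|: V k) :\: B = V i :\: B :|: V k.
Proof.
move=> sB ik; rewrite setDUl; congr (_ :|: _); apply/setDidPl.
by apply: disjointWr sB _; rewrite disjoint_sym disjV.
Qed.

Lemma leaf_compl i k B : B \subset V i -> i != k ->
  (V i :|: V k) :\: (V i :\: B :|: V k) = B.
Proof.
move=> sB ik; rewrite setDUl !setDUr setDDr setDv set0U (setIidPr sB) setDv setI0 setU0.
by apply/setIidPl; apply: subset_trans sB _; rewrite subsetD subxx disjV.
Qed.

(** An end meets V i and contains a neighbouring block, so only one edge
    contains it; the middle lies in exactly two edges, one for each end. *)
Lemma star_closed i B A A' : B \in proper_parts (V i) ->
  A \in star i B -> part_adj A A' -> A' \in star i B.
Proof.
move=> Bi; have Ci := proper_parts_compl Bi; have sB := proper_parts_sub Bi.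
have [x xB xi] : exists2 x, x \in B & x \in V i.
  move: Bi; rewrite inE => /andP[/set0Pn[x xB] pB]; exists x => //.
  exact: (subsetP sB).
have [y yC yi] : exists2 y, y \in V i :\: B & y \in V i.
  move: Ci; rewrite inE => /andP[/set0Pn[y yC] pC]; exists y => //.
  exact: (subsetP (proper_sub pC)).
have pS : i != ordS i by rewrite eq_sym ordS_neq.
have pP : i != ord_pred i by rewrite eq_sym ord_pred_neq.
move=> As /part_adjP[j [_ /proper_sub sA ->]].
have [j_i|j_i] : j = i \/ j = ord_pred i.
- have : (i == j) || (i == ordS j).
    move: As; rewrite in_starE; move/subsetP: sA => sA /or3P[]/eqP eA; rewrite eA in sA.
    + by rewrite -(cedgeP _ xi) sA.
    + by rewrite -(cedgeP _ yi) sA // inE yC.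
    + by rewrite -(cedgeP _ yi) sA // inE yC.
  by case/orP=> /eqP->; [left|right; rewrite ordSK].
- rewrite j_i in sA *; rewrite in_starE; move: As sA; rewrite in_starE.
  case/or3P=> /eqP-> sA.
  + by rewrite {1 2}/cedge center_compl // eqxx orbT.
  + by rewrite /cedge leaf_compl // eqxx.
  + move: sA; rewrite subUset V_sub_cedge (negbTE (ord_pred_neq i)) eq_sym.
    by rewrite (negbTE (ordS_neq_pred i)) andbF.
- rewrite j_i in sA *; rewrite in_starE; move: As sA; rewrite in_starE !cedge_pred.
  case/or3P=> /eqP-> sA.
  + by rewrite center_compl // eqxx !orbT.
  + move: sA; rewrite -cedge_pred subUset V_sub_cedge (negbTE (ordS_neq_pred i)) ord_predK.
    by rewrite (negbTE (ordS_neq n_gt2 i)) andbF.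
  + by rewrite leaf_compl // eqxx.
Qed.

(** The parts that split both blocks of the edge with index i. *)
Definition mixed i :=
  [set B1 :|: B2 | B1 in proper_parts (V i), B2 in proper_parts (V (ordS i))].

Lemma mixed_cap i B1 B2 : B1 \subset V i -> B2 \subset V (ordS i) ->
  (B1 :|: B2) :&: V i = B1 /\ (B1 :|: B2) :&: V (ordS i) = B2.
Proof.
move=> s1 s2; have dis : [disjoint V i & V (ordS i)] by rewrite disjV // eq_sym ordS_neq.
rewrite !setIUl (setIidPl s1) (setIidPl s2); split.
- suff -> : B2 :&: V i = set0 by rewrite setU0.
  by apply/disjoint_setI0; apply: disjointWl s2 _; rewrite disjoint_sym.
- suff -> : B1 :&: V (ordS i) = set0 by rewrite set0U.
  by apply/disjoint_setI0; apply: disjointWl s1 _.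
Qed.

(** Both pieces of the union can be recovered by intersecting with the
    blocks, so they may be chosen independently. *)
Lemma card_mixed i : #|mixed i| = ((2 ^ #|V i| - 2) * (2 ^ #|V (ordS i)| - 2))%N.
Proof.
rewrite -!card_proper_parts // -cardsX /mixed curry_imset2X card_in_imset //.
move=> [B1 B2] [C1 C2]; rewrite !in_setX /=.
move=> /andP[/proper_parts_sub b1 /proper_parts_sub b2].
move=> /andP[/proper_parts_sub c1 /proper_parts_sub c2] eBC.
have [e1 e2] := mixed_cap b1 b2; have [f1 f2] := mixed_cap c1 c2.
by congr pair; [rewrite -e1 eBC f1|rewrite -e2 eBC f2].
Qed.

Lemma split_properP A i : reflect (A :&: V i \in proper_parts (V i)) (i \in split_blocks A).
Proof. by rewrite !inE properE subsetIr subsetI subxx andbT; apply: idP. Qed.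

(** The parts that split two blocks are described in two ways: as unions,
    which makes them countable, and by the split blocks, which determine the
    edge. *)
Lemma mixedP A i :
  reflect (A \subset cedge i /\ split_blocks A = [set i; ordS i]) (A \in mixed i).
Proof.
apply: (iffP imset2P) => [[B1 B2 h1 h2 ->]|[sA sp]].
  have s1 := proper_parts_sub h1; have s2 := proper_parts_sub h2.
  have [e1 e2] := mixed_cap s1 s2; have sU : B1 :|: B2 \subset cedge i by apply: setUSS.
  split=> //; apply/eqP; rewrite eqEsubset split_sub //=.
  apply/subsetP=> k; rewrite in_set2 => /orP[]/eqP->; apply/split_properP; by rewrite ?e1 ?e2.
exists (A :&: V i) (A :&: V (ordS i)).
- by apply/split_properP; rewrite sp set21.
- by apply/split_properP; rewrite sp set22.
- by rewrite -setIUr; apply/esym/setIidPl.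
Qed.

(** With n at least 3 the pair {i, i+1} modulo n determines i; for n = 2 it
    would not. *)
Lemma mixed_disjoint i j : i != j -> [disjoint mixed i & mixed j].
Proof.
apply: contraNT => /pred0Pn[A /= /andP[/mixedP[_ si] /mixedP[_ sj]]].
have := set21 i (ordS i); rewrite -si sj !inE => /orP[//|/eqP ij].
have := set21 j (ordS j); rewrite -sj si !inE ij => /orP[/eqP jj|/eqP jj].
  by have := ordS_neq n_gt2 j; rewrite -jj eqxx.
by have := ordSS_neq n_gt2 j; rewrite -jj eqxx.
Qed.

Lemma split_parts2 :
  [set A in cparts | (split_blocks A != set0) && (#|split_blocks A| != 1%N)]
  = \bigcup_i mixed i.
Proof.
apply/setP=> A; apply/idP/bigcupP => [|[i _ /mixedP[sA sp]]].
  rewrite inE => /and3P[]; rewrite [_ \in cparts]inE => /existsP[i /andP[A0 pA]] s0 s1.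
  exists i => //; apply/mixedP; split; first exact: proper_sub.
  apply/eqP; rewrite eqEcard split_sub ?proper_sub // cards2 eq_sym ordS_neq //.
  by move: s0 s1; rewrite -cards_eq0; case: #|_| => [|[]].
rewrite inE sp cards2 [i == _]eq_sym ordS_neq // andbT.
have -> : [set i; ordS i] != set0 by apply/set0Pn; exists i; rewrite set21.
rewrite andbT inE; apply/existsP; exists i.
have /splitP[x [y [xi yi xA yA]]] : i \in split_blocks A by rewrite sp set21.
apply/andP; split; first by apply/set0Pn; exists x.
by apply/properP; split=> //; exists y => //; rewrite inE yi.
Qed.

Lemma card_split_parts2 :
  #|\bigcup_i mixed i| = (\sum_i (2 ^ #|V i| - 2) * (2 ^ #|V (ordS i)| - 2))%N.
Proof.
rewrite -sum1_card partition_disjoint_bigcup; last exact: mixed_disjoint.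
by apply: eq_bigr => i _; rewrite sum1_card card_mixed.
Qed.

Lemma support_mixed A i : A \in mixed i -> support A = cedge i.
Proof. by case/mixedP=> _ /support2. Qed.

(** The two split blocks already fill an edge, so this edge is the only one
    that contains A. *)
Lemma mixed_adj : {in \bigcup_i mixed i &, forall A B,
  part_adj A B = (B == support A :\: A)}.
Proof.
move=> A B /bigcupP[j _ Aj] _; rewrite (support_mixed Aj).
have /mixedP[sA sp] := Aj.
have /splitP[x [y [xi yi xA yA]]] : j \in split_blocks A by rewrite sp set21.
apply/part_adjP/eqP => [[k [A0 pA ->]]|->].
  suff -> : k = j by [].
  have : split_blocks A == [set k; ordS k].
    rewrite eqEcard split_sub ?proper_sub // sp !cards2.
    by rewrite ![_ == ordS _]eq_sym !(negbTE (ordS_neq _ _)).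
  move=> /eqP sk; have Ak : A \in mixed k by apply/mixedP; rewrite proper_sub.
  apply/eqP; apply: contraTT Aj => /mixed_disjoint/disjointFr-> //.
exists j; split=> //; first by apply/set0Pn; exists x.
by apply/properP; split=> //; exists y => //; rewrite inE yi.
Qed.

Section CharPoly.
Variable R : realType.
Local Notation part_poly := (induced_poly R part_adj).

Lemma part_poly_unsplit :
  part_poly [set A in cparts | split_blocks A == set0]
  = \prod_(k <- iota 1 n) ('X - (2 * cos (2 * pi * k%:R / n%:R))%:P).
Proof.
rewrite unsplit_parts (induced_poly_enum _ _ V_eq) // -char_poly_cycle //.
by congr char_poly; apply/matrixP=> i j; rewrite !mxE part_adj_V.
Qed.

Lemma part_poly_star i B : B \in proper_parts (V i) -> part_poly (star i B) = 'X ^+ 3 - 'X *+ 2.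
Proof.
move=> Bi; have Ci := proper_parts_compl Bi; have sB := proper_parts_sub Bi.
have [B0 pB] : B != set0 /\ B \proper V i by move: Bi; rewrite inE => /andP[].
have pS : i != ordS i by rewrite eq_sym ordS_neq.
have pP : i != ord_pred i by rewrite eq_sym ord_pred_neq.
apply: induced_poly_path.
- exact: part_adj_sym.
- exact: part_adj_irr.
- by apply/part_adjP; exists i; rewrite B0 (proper_sub_trans pB) ?subsetUl // center_compl.
- apply/part_adjP; exists (ord_pred i).
  by rewrite B0 cedge_pred (proper_sub_trans pB) ?subsetUl // center_compl.
- apply/existsP=> -[k /and4P[_ _ + _]].
  move: Ci; rewrite inE => /andP[/set0Pn[y yC] _].
  by move/pred0Pn; case; exists y; rewrite /= !inE in yC *; rewrite yC.
- have /set0Pn[x xS] := V_neq0 (ordS i); apply/eqP=> /setP/(_ x); rewrite !inE xS orbT.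
  move=> /esym/orP[/andP[_ xi]|xP]; first by rewrite -(V_inj xi xS) eqxx in pS.
  by have := ordS_neq_pred i; rewrite (V_inj xS xP) eqxx.
Qed.

(** [center] labels each part by the middle of its path, so the labels range
    over the non-empty proper subsets of the blocks. *)
Lemma part_poly_split1 :
  part_poly [set A in cparts | #|split_blocks A| == 1%N]
  = ('X ^+ 3 - 'X *+ 2) ^+ (\sum_i (2 ^ #|V i| - 2)).
Proof.
set W1 := [set A in _ | _].
have W1P A : A \in W1 -> exists i B, [/\ B \in proper_parts (V i), A \in star i B & center A = B].
  rewrite inE => /andP[cA /cards1P[i sp]]; have [B Bi As] := in_star cA sp.
  by exists i, B; split=> //; case: (center_star Bi As).
have starW1 i B A : B \in proper_parts (V i) -> A \in star i B -> A \in W1 /\ center A = B.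
  by move=> Bi /(center_star Bi)[cA sp ?]; rewrite inE cA sp cards1.
have cW1 : center @: W1 = \bigcup_i proper_parts (V i).
  apply/setP=> B; apply/imsetP/bigcupP=> [[A /W1P[i [B' [Bi _ ->]]] ->]|[i _ Bi]].
    by exists i.
  have Bs : B \in star i B by rewrite in_starE eqxx.
  by have [BW cB] := starW1 _ _ _ Bi Bs; exists B.
rewrite (induced_poly_uniform_fibres (c := center) (q := 'X ^+ 3 - 'X *+ 2)).
- congr (_ ^+ _); rewrite cW1 -sum1_card partition_disjoint_bigcup.
    by apply: eq_bigr => i _; rewrite sum1_card card_proper_parts.
  move=> i j; apply: contraNT => /pred0Pn[B /=]; rewrite !inE.
  case/andP=> /andP[/set0Pn[x xB] /proper_sub/subsetP sBi] /andP[_ /proper_sub/subsetP sBj].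
  by rewrite (V_inj (sBi _ xB) (sBj _ xB)).
- move=> A A' /W1P[i [B [Bi As ->]]] _ /(star_closed Bi As) A's.
  by have [_ ->] := starW1 _ _ _ Bi A's.
move=> A /W1P[i [B [Bi As cA]]].
have -> : [set A' in W1 | center A' == center A] = star i B.
  apply/setP=> A'; rewrite inE cA; apply/andP/idP => [[/W1P[j [B' [B'j A's ->]]] /eqP eB]|A's].
    suff <- : j = i by rewrite -eB.
    move: Bi B'j; rewrite eB !inE => /andP[/set0Pn[x xB] /proper_sub/subsetP sBi].
    by move=> /andP[_ /proper_sub/subsetP sBj]; rewrite (V_inj (sBi _ xB) (sBj _ xB)).
  by have [-> ->] := starW1 _ _ _ Bi A's.
exact: part_poly_star.
Qed.

Lemma part_poly_split2 : exists m,
  (2 * m = \sum_i (2 ^ #|V i| - 2) * (2 ^ #|V (ordS i)| - 2))%N /\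
  part_poly [set A in cparts | (split_blocks A != set0) && (#|split_blocks A| != 1%N)]
  = ('X ^+ 2 - 1) ^+ m.
Proof.
rewrite split_parts2 -card_split_parts2.
have [||m [-> ->]] := induced_poly_matching R part_adj_sym part_adj_irr
  (s := fun A => support A :\: A) (X := \bigcup_i mixed i).
- move=> A /bigcupP[i _ Ai]; apply/bigcupP; exists i => //; rewrite (support_mixed Ai).
  by have /mixedP[sA sp] := Ai; apply/mixedP; rewrite split_compl // subsetDl.
- exact: mixed_adj.
by exists m.
Qed.

(** Adjacent parts split the same blocks, so the graph separates according to
    the number of split blocks. *)
Lemma part_poly_cparts : exists m,
  (2 * m = \sum_i (2 ^ #|V i| - 2) * (2 ^ #|V (ordS i)| - 2))%N /\
  part_poly cparts =
    \prod_(k <- iota 1 n) ('X - (2 * cos (2 * pi * k%:R / n%:R))%:P)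
    * (('X ^+ 2 - 1) ^+ m * ('X ^+ 3 - 'X *+ 2) ^+ (\sum_i (2 ^ #|V i| - 2))).
Proof.
have [m [cm poly2]] := part_poly_split2; exists m; split=> //.
rewrite (@induced_poly_split _ _ _ (fun A => split_blocks A == set0)); last first.
  by move=> A B _ _; apply: contraNF => /part_adj_split->.
rewrite part_poly_unsplit.
rewrite (@induced_poly_split _ _ _ (fun A => #|split_blocks A| == 1%N)); last first.
  by move=> A B _ _; apply: contraNF => /part_adj_split->.
congr (_ * _); rewrite mulrC -poly2 -part_poly_split1; congr (part_poly _ * part_poly _).
  by apply/setP=> A; rewrite !inE -!andbA.
apply/setP=> A; rewrite !inE -andbA; congr (_ && _).
by case: (eqVneq (split_blocks A) set0) => [->|]; rewrite ?cards0.
Qed.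

End CharPoly.

End Blocks.

(** * Two-partitions and counting *)

Section Tau.
Variable T : finType.
Implicit Types (e A B : {set T}).

(** For A = B both sides are false: the pair collapses to one set, and a set
    disjoint from itself is empty. *)
Lemma set2_tau e A B : ([set A; B] \in tau e) =
  [&& A != set0, B != set0, [disjoint A & B] & A :|: B == e].
Proof.
rewrite inE /partition /cover bigcup_setU !big_set1 !inE negb_or ![set0 == _]eq_sym cards2.
case: (eqVneq A B) => [<-|AB] /=.
  rewrite andbF -setI_eq0 setIid; case: (A == set0) => //=.
rewrite andbT; have -> : trivIset [set A; B] = [disjoint A & B].
  apply/trivIsetP/idP => [dAB|dAB C D]; first by apply: dAB; rewrite ?set21 ?set22.
  by rewrite !inE => /orP[]/eqP-> /orP[]/eqP->; rewrite ?eqxx // disjoint_sym.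
by rewrite andbC -!andbA andbCA andbC -!andbA; do !bool_congr.
Qed.

Lemma tauP e Q :
  reflect (exists2 A, A \in proper_parts e & Q = [set A; e :\: A]) (Q \in tau e).
Proof.
apply: (iffP idP) => [Qe|[A Ae ->]]; last first.
  move: Ae; rewrite inE set2_tau => /andP[-> /properP[sA [x xe xA]]] /=; apply/and3P; split.
  - by apply/set0Pn; exists x; rewrite inE xA.
  - by rewrite -setI_eq0 setIDA setDIl setDv set0I.
  - by rewrite -{1}(setIidPr sA) setID.
have : #|Q| == 2 by move: Qe; rewrite inE => /andP[].
move=> /cards2P[A [B [AB QE]]]; rewrite QE set2_tau in Qe *.
case/and4P: Qe => A0 /set0Pn[x xB] dAB /eqP eE; exists A.
  rewrite inE A0 -eE; apply/properP; split; first exact: subsetUl.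
  by exists x; rewrite ?inE ?xB ?orbT // (disjointFl dAB xB).
by rewrite -eE setDUl setDv set0U; congr [set A; _]; apply/esym/setDidPl; rewrite disjoint_sym.
Qed.

Lemma parts_proper e : parts e = proper_parts e.
Proof.
apply/setP=> A; apply/bigcupP/idP => [[Q /tauP[B Be ->]]|Ae]; last first.
  by exists [set A; e :\: A]; rewrite ?set21 //; apply/tauP; exists A.
by rewrite in_set2 => /orP[]/eqP-> //; apply: proper_parts_compl.
Qed.

(** The 2-partitions, as two-element sets, partition the set of all non-empty
    proper subsets of e. *)
Lemma card_tau e : e != set0 -> (2 * #|tau e| = 2 ^ #|e| - 2)%N.
Proof.
move=> e0; rewrite -card_proper_parts // mulnC; apply/esym.
apply: card_uniform_partition => [Q|]; first by rewrite inE => /andP[_ /eqP].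
apply/and3P; split; first by rewrite -parts_proper.
- have inQ Q A : Q \in tau e -> A \in Q -> Q = [set A; e :\: A].
    move=> /tauP[B Be ->]; rewrite in_set2 => /orP[]/eqP-> //.
    by rewrite setDDr setDv set0U (setIidPr (proper_parts_sub Be)) setUC.
  apply/trivIsetP=> P Q Pe Qe; apply: contraNT => /pred0Pn[A /= /andP[AP AQ]].
  by rewrite (inQ _ _ Pe AP) (inQ _ _ Qe AQ).
by apply/negP; rewrite inE cards0 andbF.
Qed.
End Tau.

Lemma sum_bin_proper a : (0 < a)%N -> (\sum_(1 <= l < a) 'C(a, l) = 2 ^ a - 2)%N.
Proof.
case: a => // a _; have -> : (2 ^ a.+1 = \sum_(i < a.+2) 'C(a.+1, i))%N.
  by rewrite -[2%N]addn1 Pascal; apply: eq_bigr => i _; rewrite !exp1n !muln1.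
rewrite big_ord_recr big_ord_recl /= bin0 binn add1n addn1 subn2 /=.
by rewrite big_add1 big_mkord.
Qed.

Section UnifiedCycle.
Variables (T : finType) (EC : hypergraph T) (n : nat) (S : nat -> {set T}).
Hypothesis hEC : unified_cycle EC n S.

Definition blocks (i : 'I_n) : {set T} := S i.

Let n_gt2 : (2 < n)%N := uc_length hEC.

Lemma blocks_neq0 i : blocks i != set0.
Proof. exact: (uc_neq0 hEC). Qed.

Lemma blocks_inj x i j : x \in blocks i -> x \in blocks j -> i = j.
Proof.
move=> xi xj; apply/eqP; apply: contraTT xj => ij.
by rewrite (disjointFr (uc_disjoint hEC (ltn_ord i) (ltn_ord j) ij)).
Qed.

Lemma blocks_ordS i : blocks (ordS i) = S i.+1.
Proof.
rewrite /blocks /=; have := ltn_ord i; rewrite leq_eqVlt => /orP[/eqP in_|in_].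
  by rewrite in_ modnn (uc_closed hEC).
by rewrite modn_small.
Qed.

Lemma edge_multE e : edge_mult EC e = (e \in [set cedge blocks i | i : 'I_n]).
Proof.
rewrite (uc_edges hEC); congr nat_of_bool; apply/hasP/imsetP => [[k]|[i _ ->]].
  rewrite mem_iota add1n ltnS; case: k => // k /= kn /eqP->.
  by exists (Ordinal kn); rewrite // /cedge blocks_ordS.
by exists i.+1; rewrite ?mem_iota ?add1n ?ltnS //= /cedge blocks_ordS.
Qed.

Lemma edgesE : edges EC = [set cedge blocks i | i : 'I_n].
Proof. by apply/setP=> e; rewrite inE edge_multE lt0b. Qed.

(** The singletons add nothing to the parts: every edge has at least two
    points. *)
Lemma unified_indexE : unified_index EC = cparts blocks.
Proof.
apply/setP=> A; rewrite inE edgesE; apply/orP/idP => [[/bigcupP[_ /imsetP[i _ ->]]|]|].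
- by rewrite parts_proper !inE => h; apply/existsP; exists i.
- case/imsetP=> v; rewrite (uc_vertices hEC) => /bigcupP[i _ vi] ->.
  rewrite inE; apply/existsP; exists i.
  have -> : [set v] != set0 by apply/set0Pn; exists v; rewrite inE.
  rewrite (sub_proper_trans _ (proj1 (andP (V_proper_cedge n_gt2 blocks_neq0 blocks_inj i)))) //.
  by rewrite sub1set.
rewrite inE => /existsP[i h]; left; apply/bigcupP; exists (cedge blocks i); first exact: imset_f.
by rewrite parts_proper inE.
Qed.

Lemma char_poly_unified (R : comNzRingType) :
  char_poly (unified_matrix R EC) = induced_poly R (part_adj blocks) (cparts blocks).
Proof.
rewrite -unified_indexE; congr char_poly; apply/matrixP=> i j; rewrite !mxE; congr _%:R.
rewrite edgesE; congr nat_of_bool; apply/existsP/existsP => [[e /andP[/imsetP[k _ ->]]]|[k]].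
  by rewrite set2_tau => h; exists k.
by rewrite -set2_tau => h; exists (cedge blocks k); rewrite imset_f.
Qed.

Lemma cedge_inj : injective (cedge blocks).
Proof.
move=> i j eij; have VS := V_sub_cedge blocks_neq0 blocks_inj.
have : blocks i \subset cedge blocks j by rewrite -eij subsetUl.
rewrite VS => /orP[/eqP//|/eqP ij].
have : blocks j \subset cedge blocks i by rewrite eij subsetUl.
rewrite VS => /orP[/eqP//|/eqP ji].
by have := ordSS_neq n_gt2 i; rewrite -ji -ij eqxx.
Qed.

Let a (i : 'I_n) := (2 ^ #|blocks i| - 2)%N.

Lemma pow_blocks i : (2 ^ #|blocks i| = a i + 2)%N.
Proof.
rewrite /a subnK // -[X in (X <= _)%N](expn1 2) leq_exp2l // card_gt0.
exact: blocks_neq0.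
Qed.

(** Since 2 ^ |S_i| = a_i + 2, twice the number of 2-partitions of the edge
    S_i + S_(i+1) is (a_i + 2) (a_(i+1) + 2) - 2; expanding gives the formula,
    because a_i and a_(i+1) have the same sum around the cycle. *)
Lemma sum_tauE : (2 * sum_tau EC = \sum_i a i * a (ordS i) + 4 * \sum_i a i + 2 * n)%N.
Proof.
have -> : sum_tau EC = (\sum_i #|tau (cedge blocks i)|)%N.
  rewrite /sum_tau -(big_imset (fun e => #|tau e|) (in2W cedge_inj)) /= [RHS]big_mkcond.
  by apply: eq_bigr => e _; rewrite edge_multE; case: (_ \in _); rewrite ?mul1n.
have -> : (4 * \sum_i a i = \sum_i 2 * a i + \sum_i 2 * a (ordS i))%N.
  have aS : (\sum_i a (ordS i) = \sum_i a i)%N by rewrite [RHS](reindex_inj (@ordS_inj n)).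
  by rewrite -!big_distrr /= aS -mulnDl.
have -> : (2 * n = \sum_(i < n) 2)%N by rewrite sum_nat_const card_ord mulnC.
rewrite big_distrr -!big_split /=; apply: eq_bigr => i _.
have c0 : cedge blocks i != set0.
  by have /set0Pn[x xi] := blocks_neq0 i; apply/set0Pn; exists x; rewrite inE xi.
rewrite card_tau // cardsU disjoint_setI0; last first.
  by apply: disjV blocks_inj _ _ _; rewrite eq_sym ordS_neq.
rewrite cards0 subn0 expnD !pow_blocks; nia.
Qed.

(** If one of the blocks is a singleton the product on the right is zero too,
    so the case distinction disappears. *)
Lemma cycle_pE (i : 'I_n) : cycle_p S i.+1 = 2^-1 * (a i * a (ordS i))%:R.
Proof.
rewrite /cycle_p /= -blocks_ordS -/(blocks i) /a.
case: ifP => [/orP[]/eqP->|_]; rewrite ?subnn ?mul0n ?muln0 ?mulr0 //.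
congr (_ * _); rewrite -!sum_bin_proper ?card_gt0 ?blocks_neq0 //.
rewrite big_distrlr natr_sum; apply: eq_bigr => l1 _.
by rewrite natr_sum.
Qed.

Lemma cycle_t1E m : (2 * m = \sum_i a i * a (ordS i))%N -> cycle_t1 n S = m%:R.
Proof.
move=> mE; rewrite /cycle_t1 big_add1 big_mkord.
under eq_bigr do rewrite cycle_pE.
by rewrite -big_distrr /= -natr_sum -mE natrM mulKf.
Qed.

Lemma cycle_t2E m : (2 * m = \sum_i a i * a (ordS i))%N ->
  cycle_t2 EC n S = (\sum_i a i)%:R.
Proof.
move=> mE; rewrite /cycle_t2 (cycle_t1E mE).
have -> : sum_tau EC = (m + 2 * \sum_i a i + n)%N by have := sum_tauE; rewrite -mE; lia.
by rewrite !natrD addr0; field.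
Qed.

End UnifiedCycle.

(** * The unified spectrum *)

Lemma prod_nseq (R : comNzRingType) (I : Type) (F : I -> R) k x :
  \prod_(y <- nseq k x) F y = F x ^+ k.
Proof. by rewrite big_nseq iter_mulr_1. Qed.

Theorem theorem7p1 (R : realType) (T : finType) (EC : hypergraph T) (n : nat)
    (S : nat -> {set T}) (hEC : unified_cycle EC n S)
    (hS : exists i : nat, (1 <= i <= n)%N /\ (1 < #|S i|)%N) :
  exists m1 m2 : nat,
    [/\ m1%:R = cycle_t1 n S,
        m2%:R = cycle_t2 EC n S &
        unified_eigenvalues EC
          ([seq 2 * cos (2 * pi * k%:R / n%:R) | k <- iota 1 n]
           ++ (if has (fun i => (1 < #|S i.-1|)%N && (1 < #|S i|)%N) (iota 1 n)
               then nseq m1 1 ++ nseq m1 (- 1) else [::])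
           ++ (if (sum_tau EC)%:R != n%:R + cycle_t1 n S
               then nseq m2 0 ++ nseq m2 (Num.sqrt 2) ++ nseq m2 (- Num.sqrt 2)
               else [::])
           : seq R)].
Proof.
have [m [mE polyE]] := part_poly_cparts (uc_length hEC) (blocks_neq0 hEC)
  (@blocks_inj _ _ _ _ hEC) R.
set a : nat := (\sum_i _)%N in polyE.
have t1E := cycle_t1E hEC mE; have t2E := cycle_t2E hEC mE; rewrite -/a in t2E.
exists m, a; split=> //.
rewrite /unified_eigenvalues (char_poly_unified hEC) {}polyE !big_cat /= big_map.
congr (_ * (_ * _)).
(* When no two consecutive blocks both have several points, m = 0 and the
   empty list is right anyway; the same happens for the paths below. *)
- case: ifP => [_|/hasPn no_pair].
    by rewrite big_cat !prod_nseq /= -exprMn /=; congr (_ ^+ m); rewrite polyCN; ring.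
  suff -> : m = 0%N by rewrite expr0 big_nil.
  apply/eqP; rewrite -(eqn_pmul2l (isT : 0 < 2)%N) mE muln0 sum_nat_eq0.
  apply/forallP=> i; apply/implyP=> _; rewrite muln_eq0 (blocks_ordS hEC) /blocks.
  have /no_pair : i.+1 \in iota 1 n by rewrite mem_iota /= add1n ltnS ltn_ord.
  rewrite /= negb_and -!leqNgt => /orP[]; have := blocks_neq0 hEC i; rewrite -card_gt0 /blocks.
  + by case: #|_| => [|[]].
  + have := blocks_neq0 hEC (ordS i); rewrite -card_gt0 (blocks_ordS hEC) orbC.
    by case: #|S i.+1| => [|[]].
(* The condition on sum_tau says that a is not zero. *)
- have sE : (sum_tau EC)%:R = n%:R + cycle_t1 n S + (2 * a)%:R :> rat.
    by move: t2E; rewrite /cycle_t2 natrM => <-; field.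
  rewrite {}sE -subr_eq0 [X in X != 0](_ : _ = (2 * a)%:R); last by ring.
  rewrite pnatr_eq0 muln_eq0 /=.
  case: ifP => [_|/negbT/negPn/eqP a0].
    rewrite !big_cat !prod_nseq /= -!exprMn /=; congr (_ ^+ a).
    have s2 : (Num.sqrt 2)%:P ^+ 2 = 2 :> {poly R}.
      by rewrite -polyC_exp sqr_sqrtr ?ler0n // rmorph_nat.
    by rewrite polyCN opprK -subr_sqr s2 polyC0; ring.
  by rewrite a0 expr0 big_nil.
Qed.
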